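(* Let $X$, $Y$ be Banach spaces and let $L$ be a nonempty locally compact Hausdorff space. If the pair $(X, \mathcal{C}_0(L,Y))$ has the BPBp, then the pair $(X,Y)$ has the BPBp.
   Context: Banach spaces are real or complex (all over the same scalar field). For a Banach space $X$, $S_X$ is the unit sphere. $\mathcal{L}(X,Y)$ is the Banach space of bounded linear operators from $X$ into $Y$ with the operator norm. $\mathcal{C}_0(L,Y)$ is the Banach space of all continuous functions from $L$ into $Y$ that vanish at infinity, with the supremum norm. BPBp: a pair $(X,Y)$ of Banach spaces has the Bishop-Phelps-Bollobás property for operators (BPBp) if, given $\varepsilon>0$, there is $\eta(\varepsilon)>0$ such that for every $T\in S_{\mathcal{L}(X,Y)}$ and $x_0\in S_X$ with $\|Tx_0\|>1-\eta(\varepsilon)$, there exist $S\in S_{\mathcal{L}(X,Y)}$ and $u_0\in S_X$ such that $\|Su_0\|=1$, $\|u_0-x_0\|<\varepsilon$ and $\|S-T\|<\varepsilon$. *)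

(* Defs.v *)
From HB Require Import structures.
From mathcomp Require Import all_boot all_order all_algebra.
From mathcomp Require Import complex.
From mathcomp Require Import all_classical all_reals all_analysis.
Import numFieldNormedType.Exports.
Import Order.TTheory GRing.Theory Num.Theory.

Set Implicit Arguments.
Unset Strict Implicit.
Unset Printing Implicit Defensive.

Local Open Scope classical_set_scope.
Local Open Scope ring_scope.

Variant scalar_kind := RealScalars | ComplexScalars.

Definition scalar_field (R : realType) (k : scalar_kind) : numFieldType :=
  match k with
  | RealScalars => R
  | ComplexScalars => (R[i] : numFieldType)
  end.

(* In MathComp-Analysis the norm of a normed module over K takes its values in
   K.  In R[i], x <= y means Re x <= Re y and Im x = Im y, so that 0 < e forces
   e to be real and the supremum of a nonempty bounded set of norms is its
   usual real supremum. *)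
Lemma scalar_supremums (R : realType) k (A : set (scalar_field R k)) :
  A !=set0 -> has_ubound A -> supremums A !=set0.
Proof.
case: k A => /= A [a Aa] [u uA].
  exists (sup A); split=> [x Ax|y yA].
    by apply: ub_le_sup => //; exists u.
  by apply: ge_sup => //; exists a.
pose B := @complex.Re R @` A.
have B0 : B !=set0 by exists (complex.Re a), a.
have imA x : A x -> complex.Im x = complex.Im u.
  by move=> /uA; rewrite lecE => /andP[/eqP].
have uB y : ubound A y -> ubound B (complex.Re y).
  by move=> yA _ [x Ax <-]; have := yA _ Ax; rewrite lecE => /andP[].
exists (Complex (sup B) (complex.Im u)); split=> [x Ax|y yA].
  rewrite lecE /= (imA _ Ax) eqxx /=; apply: ub_le_sup; last by exists x.
  by exists (complex.Re u); exact: uB.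
have := yA _ Aa; rewrite !lecE /= (imA _ Aa) => /andP[-> _] /=.
by apply: ge_sup => //; exact: uB.
Qed.

Lemma supremum_le (K : numFieldType) (A : set K) (x0 u : K) :
  supremums A !=set0 -> A !=set0 -> ubound A u -> supremum x0 A <= u.
Proof.
move=> sA [a Aa] uA; rewrite /supremum ifF; last first.
  by apply/eqP => A0; rewrite A0 in Aa.
by case: sA => s sA; case: xgetP => [y -> [_]|/(_ s)//]; exact.
Qed.

Lemma supremum_ub (K : numFieldType) (A : set K) (x0 x : K) :
  supremums A !=set0 -> A x -> x <= supremum x0 A.
Proof.
move=> [s sA] Ax; rewrite /supremum ifF; last first.
  by apply/eqP => A0; rewrite A0 in Ax.
by case: xgetP => [y -> [+ _]|/(_ s)//]; exact.
Qed.

Section bounded_operators.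
Variables (K : numFieldType) (X Y : normedModType K).

Definition bounded_op (T : X -> Y) := exists M : K, forall x, `|T x| <= M * `|x|.

Definition opnorm (T : X -> Y) : K :=
  supremum 0 [set `|T x| | x in [set x : X | `|x| <= 1]].

(* Membership in the unit sphere of L(X, Y). *)
Definition op_sphere (T : {linear X -> Y}) := bounded_op T /\ opnorm T = 1.

Definition BPBp :=
  forall eps : K, 0 < eps -> exists2 eta : K, 0 < eta &
    forall (T : {linear X -> Y}) (x0 : X),
      op_sphere T -> `|x0| = 1 -> `|T x0| > 1 - eta ->
      exists (S : {linear X -> Y}) (u0 : X),
        [/\ op_sphere S, `|u0| = 1, `|S u0| = 1,
            `|u0 - x0| < eps & opnorm (S \- T) < eps].

End bounded_operators.

Definition vanishes_at_infinity (K : numFieldType) (L : topologicalType)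
    (Y : normedModType K) (f : L -> Y) :=
  forall e : K, 0 < e ->
    exists2 C : set L, compact C & forall t, ~ C t -> `|f t| < e.

Section C0_space.
Variables (R : realType) (k : scalar_kind) (L : topologicalType).
Local Notation K := (scalar_field R k).

Section normed.
Variable Y : normedModType K.

Definition C0_pred : {pred L -> Y} :=
  fun f => `[< continuous f /\ vanishes_at_infinity f >].

Record C0 := MkC0 { C0_fun :> L -> Y; C0_funP : C0_fun \in C0_pred }.

HB.instance Definition _ := [isSub for C0_fun].
HB.instance Definition _ := [Choice of C0 by <:].

Lemma C0_continuous (f : C0) : continuous f.
Proof. by case: f => f /= /asboolP[]. Qed.

Lemma C0_vanish (f : C0) : vanishes_at_infinity f.
Proof. by case: f => f /= /asboolP[]. Qed.

Fact C0_submod_closed : submod_closed C0_pred.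
Proof.
split=> [|a f g /asboolP[cf vf] /asboolP[cg vg]]; apply/asboolP; split.
- by move=> t; exact: cst_continuous.
- move=> e e0; exists set0; first exact: compact0.
  by move=> t _; rewrite /= normr0.
- move=> t; apply: (@cvgD _ _ _ _ _ (fun u => a *: f u) g); last exact: cg.
  by apply: cvgZr; exact: cf.
- move=> e e0.
  have a0 : 0 < `|a| + 1 by rewrite ltr_wpDl.
  have [C cC Cf] := vf (e / 2 / (`|a| + 1)) (divr_gt0 (divr_gt0 e0 (ltr0n _ 2)) a0).
  have [D cD Dg] := vg (e / 2) (divr_gt0 e0 (ltr0n _ 2)).
  exists (C `|` D); first exact: compactU.
  move=> t /not_orP[/Cf ft /Dg gt].
  rewrite (le_lt_trans (ler_normD _ _))// [ltRHS]splitr ler_ltD//.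
  move: ft; rewrite ltr_pdivlMr// => /ltW; apply: le_trans.
  by rewrite normrZ mulrC ler_wpM2l// lerDl.
Qed.

HB.instance Definition _ :=
  GRing.isSubmodClosed.Build K (L -> Y) C0_pred C0_submod_closed.
HB.instance Definition _ := [SubChoice_isSubLmodule of C0 by <:].

Definition C0_norm (f : C0) : K := supremum 0 [set `|f t| | t in [set: L]].

Lemma C0_bounded (f : C0) : has_ubound [set `|f t| | t in [set: L]].
Proof.
have [C /compact_near_coveringP cC Cf] := C0_vanish f ltr01.
have : \forall M \near +oo, C `<=` (fun t => `|f t| <= M).
  apply: cC => t _.
  have ft : `|f t| + 1 \is Num.real by rewrite realD.
  exists ([set u | `|f u| < `|f t| + 1], [set M | `|f t| + 1 < M]) => /=.
    split; last by exists (`|f t| + 1).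
    have ft1 : \forall u \near t, `|f t - f u| < 1.
      exact: ((cvgrPdist_lt _ _).1 (@C0_continuous f t)).
    apply: filterS ft1 => u /= ftu; rewrite -ltrBlDl.
    by rewrite (le_lt_trans _ ftu)// distrC lerB_dist.
  by move=> [u M] /= [fu fM]; exact/ltW/(lt_trans fu fM).
move=> /pinfty_ex_gt0[M M0 CM]; exists (M + 1) => _ [t _ <-].
have [/CM ftM|/Cf/ltW ft] := pselect (C t).
  by rewrite (le_trans ftM)// lerDl.
by rewrite (le_trans ft)// lerDr ltW.
Qed.

Lemma C0_norm_ub (f : C0) t : `|f t| <= C0_norm f.
Proof.
apply: supremum_ub; last by exists t.
by apply: scalar_supremums (C0_bounded f); exists `|f t|, t.
Qed.

Lemma C0_norm_le (f : C0) M : 0 <= M -> (forall t, `|f t| <= M) ->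
  C0_norm f <= M.
Proof.
move=> M0 fM; have [[t _]|L0] := pselect ([set: L] !=set0); last first.
  rewrite /C0_norm (_ : [set _ | _ in _] = set0) ?supremum0//.
  by rewrite -subset0 => x [t Lt _]; apply: L0; exists t.
have ft0 : [set `|f t| | t in [set: L]] !=set0 by exists `|f t|, t.
apply: supremum_le => //; last by move=> _ [u _ <-].
exact: scalar_supremums (C0_bounded f).
Qed.

Lemma C0_norm_ge0 (f : C0) : 0 <= C0_norm f.
Proof.
have [[t _]|L0] := pselect ([set: L] !=set0).
  exact: le_trans (normr_ge0 _) (C0_norm_ub f t).
rewrite /C0_norm (_ : [set _ | _ in _] = set0) ?supremum0//.
by rewrite -subset0 => x [t Lt _]; apply: L0; exists t.
Qed.

Fact C0_normD f g : C0_norm (f + g) <= C0_norm f + C0_norm g.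
Proof.
apply: C0_norm_le => [|t]; first by rewrite addr_ge0 ?C0_norm_ge0.
by rewrite (le_trans (ler_normD _ _))// lerD// C0_norm_ub.
Qed.

Fact C0_normZ (a : K) f : C0_norm (a *: f) = `|a| * C0_norm f.
Proof.
have le b g : C0_norm (b *: g) <= `|b| * C0_norm g.
  apply: C0_norm_le => [|t]; first by rewrite mulr_ge0 ?C0_norm_ge0.
  by rewrite [_ t](_ : _ = b *: g t)// normrZ ler_wpM2l// C0_norm_ub.
apply/eqP; rewrite eq_le le /=.
have [->|a0] := eqVneq a 0; first by rewrite normr0 mul0r C0_norm_ge0.
rewrite -ler_pdivlMl ?normr_gt0// -normfV.
by rewrite -[f in leLHS](scalerK a0) le.
Qed.

Fact C0_norm0_eq0 f : C0_norm f = 0 -> f = 0.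
Proof.
move=> f0; apply/val_inj/funext => t /=; apply/eqP.
by rewrite -normr_le0 -f0 C0_norm_ub.
Qed.

HB.instance Definition _ :=
  Lmodule_isNormed.Build K C0 C0_normD C0_normZ C0_norm0_eq0.

End normed.

Section complete.
Variable Y : completeNormedModType K.

Fact C0_complete (F : set_system (C0 Y)) : ProperFilter F -> cauchy F -> cvg F.
Proof.
move=> FF /cauchy_ballP Fc.
have Fc' (e : K) : 0 < e ->
    \forall f \near F & g \near F, forall t, `|(f : C0 Y) t - (g : C0 Y) t| < e.
  move=> /Fc; apply: filterS => -[f g] /=; rewrite -ball_normE /= => fge t.
  by rewrite (le_lt_trans _ fge)//; exact: (C0_norm_ub (f - g) t).
have Ft t : cvg ((fun f : C0 Y => f t) @ F).
  apply: cauchy_cvg; apply/cauchy_ballP => e e0.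
  rewrite near_simpl; apply: filterS (Fc' e e0) => -[f h] /= fh.
  by rewrite -ball_normE; exact: fh.
pose g t := lim ((fun f : C0 Y => f t) @ F).
have Fg (e : K) : 0 < e ->
    \forall f \near F, forall t, `|g t - (f : C0 Y) t| <= e.
  move=> e0; have e20 : 0 < e / 2 by rewrite divr_gt0.
  near=> f => t; near F => h.
  rewrite -(subrKA (h t)) (le_trans (ler_normD _ _))// [leRHS]splitr lerD//.
    near: h; exact: ((cvgrPdist_le _ _).1 (Ft t)).
  rewrite distrC; apply/ltW; move: (t); near: h; near: f; apply: nearP_dep.
  exact: Fc'.
have g_C0 : g \in @C0_pred Y.
  apply/asboolP; split.
    move=> t; apply/cvgrPdist_le => e e0.
    have e30 : 0 < e / 3 by rewrite divr_gt0.
    have [f gf] := filter_ex (Fg _ e30).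
    have ft3 : \forall u \near t, `|f t - f u| <= e / 3.
      exact: ((cvgrPdist_le _ _).1 (@C0_continuous _ f t)).
    apply: filterS ft3 => u ftu.
    rewrite -(subrKA (f t)) -[f t - g u](subrKA (f u)).
    have -> : e = e / 3 + (e / 3 + e / 3).
      by rewrite -!mulrDl -mulr2n -mulrS -[e *+ 3]mulr_natr mulfK.
    rewrite (le_trans (ler_normD _ _))// lerD//.
    rewrite (le_trans (ler_normD _ _))// lerD//.
    by rewrite distrC.
  move=> e e0; have e20 : 0 < e / 2 by rewrite divr_gt0.
  have [f gf] := filter_ex (Fg _ e20).
  have [C cC Cf] := C0_vanish f e20; exists C => // t /Cf ft.
  rewrite -(subrK (f t) (g t)) (le_lt_trans (ler_normD _ _))//.
  by rewrite [ltRHS]splitr ler_ltD.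
apply/cvg_ex; exists (MkC0 g_C0); apply/cvgrPdist_le => e e0.
apply: filterS (Fg _ e0) => f gf.
by apply: (@C0_norm_le _ (MkC0 g_C0 - f)) (ltW e0) gf.
Unshelve. all: by end_near. Qed.

HB.instance Definition _ := Uniform_isComplete.Build (C0 Y) C0_complete.

End complete.

End C0_space.
Arguments C0 {R k} L Y.

(* Main.v *)
Require Import Defs.
From HB Require Import structures.
From mathcomp Require Import all_boot all_order all_algebra.
From mathcomp Require Import complex.
From mathcomp Require Import all_classical all_reals all_analysis.
Import numFieldNormedType.Exports.
Import Order.TTheory GRing.Theory Num.Theory.

Set Implicit Arguments.
Unset Strict Implicit.
Unset Printing Implicit Defensive.

Local Open Scope classical_set_scope.
Local Open Scope ring_scope.

(** The space [Y] sits inside [C0 L Y] as the functions [t |-> phi t *: y],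
    where [phi : L -> [0, 1]] is a bump function in [C0] with [phi t0 = 1] at
    some point [t0]; such a function exists by Urysohn's lemma, because [L] is
    locally compact and Hausdorff ([exists_bump]).  In the other direction, the
    evaluation at a point is a contraction from [C0 L Y] to [Y].

    Given [T : X -> Y] of norm 1 almost attaining its norm at [x0], the operator
    [x |-> phi(.) *: T x] into [C0 L Y] has norm 1 too and almost attains its
    norm at [x0], as [phi t0 = 1].  The property of [(X, C0 L Y)] yields an
    operator [S] of norm 1 within [delta] of it and a unit vector [u0] within
    [delta] of [x0] with [`|S u0| = 1].  A function in [C0 L Y] attains its norm
    ([C0_norm_attained]), so [`|S u0 t1| = 1] for some [t1], and the operator
    [x |-> S x t1] attains its norm, which is 1, at [u0].

    It remains to compare it with [T], since [t1] need not be [t0].  The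
    operator [x |-> S x t1] is within [delta] of [phi t1 *: T]; comparing the
    two at [u0] gives [1 <= phi t1 + delta].  Hence [phi t1 *: T] is within
    [delta] of [T], and [x |-> S x t1] is within [2 * delta] of [T]. *)

Section operator_norm.
Variables (R : realType) (k : scalar_kind).
Local Notation K := (scalar_field R k).
Variables X Y : normedModType K.
Implicit Types T : {linear X -> Y}.

Lemma bounded_op_supremums T : bounded_op T ->
  supremums [set `|T x| | x in [set x : X | `|x| <= 1]] !=set0.
Proof.
move=> [M TM]; apply: scalar_supremums.
  by exists `|T 0|; exists 0 => //=; rewrite normr0 ler01.
(* [M] may fail to be nonnegative when [X] is trivial. *)
exists `|M| => _ [x /= x1 <-]; apply: le_trans (TM x) _.
rewrite (@le_trans _ _ (`|M| * `|x|))//; last by rewrite ler_piMr.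
have [->|x0] := eqVneq x 0; first by rewrite normr0 !mulr0.
rewrite ler_wpM2r// real_ler_norm// ger0_real//.
by rewrite -(pmulr_lge0 _ (_ : 0 < `|x|)) ?normr_gt0// (le_trans _ (TM x)).
Qed.

Lemma opnorm_ub T x : bounded_op T -> `|T x| <= opnorm T * `|x|.
Proof.
move=> bT; have [->|x0] := eqVneq x 0; first by rewrite linear0 !normr0 mulr0.
have nx0 : 0 < `|x| by rewrite normr_gt0.
rewrite -ler_pdivrMr//.
have -> : `|T x| / `|x| = `|T (`|x|^-1 *: x)|.
  by rewrite linearZ normrZ normfV normr_id mulrC.
apply: supremum_ub; first exact: bounded_op_supremums.
exists (`|x|^-1 *: x) => //=.
by rewrite normrZ normfV normr_id mulVf ?gt_eqF.
Qed.

Lemma opnorm_le T (M : K) : 0 <= M -> (forall x, `|T x| <= M * `|x|) ->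
  opnorm T <= M.
Proof.
move=> M0 TM; apply: supremum_le.
- by apply: bounded_op_supremums; exists M.
- by exists `|T 0|; exists 0 => //=; rewrite normr0 ler01.
- by move=> _ [x /= x1 <-]; rewrite (le_trans (TM x))// ler_piMr.
Qed.

Lemma op_sphere_contraction T : op_sphere T -> forall x, `|T x| <= `|x|.
Proof. by move=> [bT T1] x; rewrite -[leRHS]mul1r -T1 opnorm_ub. Qed.

Lemma op_sphere_attained T u :
  (forall x, `|T x| <= `|x|) -> `|u| = 1 -> `|T u| = 1 -> op_sphere T.
Proof.
move=> Tle u1 Tu1.
have Tle1 x : `|T x| <= 1 * `|x| by rewrite mul1r.
have bT : bounded_op T by exists 1.
split=> //; apply/le_anti/andP; split; first exact: opnorm_le.
by rewrite -Tu1 (le_trans (opnorm_ub u bT))// u1 mulr1.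
Qed.

End operator_norm.

Lemma op_sphere_eq_norm (K : numFieldType) (X Y Z : normedModType K)
    (T : {linear X -> Y}) (T' : {linear X -> Z}) :
  (forall x, `|T' x| = `|T x|) -> op_sphere T -> op_sphere T'.
Proof.
move=> T'T [[M TM] T1]; split; first by exists M => x; rewrite T'T.
by rewrite -T1; congr (supremum 0 (_ @` _)); apply/funext => x.
Qed.

Section C0_functions.
Variables (R : realType) (k : scalar_kind) (L : topologicalType).
Local Notation K := (scalar_field R k).

(** If [`|f t| < `|f|] everywhere, then by compactness there is a positive gap
    [e] with [`|f t| + e < `|f|] on a compact set outside of which
    [`|f t| < `|f| / 2]; the supremum would then be strictly below [`|f|]. *)
Lemma C0_norm_attained (Y : normedModType K) (f : C0 L Y) :
  f != 0 -> exists t, `|f t| = `|f|.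
Proof.
move=> f0; have nf0 : 0 < `|f| by rewrite normr_gt0.
apply: contrapT => nt.
have lt_f t : `|f t| < `|f|.
  rewrite lt_neqAle; apply/andP; split; last exact: (C0_norm_ub f t).
  by apply/eqP => ft; apply: nt; exists t.
have nf20 : 0 < `|f| / 2 by rewrite divr_gt0.
have [C /compact_near_coveringP cC Cf] := C0_vanish f nf20.
have : \forall e \near (0 : K)^'+, C `<=` (fun t => `|f t| + e < `|f|).
  apply: cC => t _.
  have d0 : 0 < (`|f| - `|f t|) / 2 by rewrite divr_gt0// subr_gt0.
  exists ([set u | `|f u| < `|f t| + (`|f| - `|f t|) / 2],
          [set e | e < (`|f| - `|f t|) / 2]) => /=.
    split; last exact: nbhs_right_lt.
    have ft : \forall u \near t, `|f t - f u| < (`|f| - `|f t|) / 2.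
      exact: ((cvgrPdist_lt _ _).1 (@C0_continuous _ _ _ _ f t)).
    apply: filterS ft => u /= ftu; rewrite -ltrBlDl.
    by rewrite (le_lt_trans _ ftu)// distrC lerB_dist.
  move=> [u e] /= [fu eu]; rewrite (lt_le_trans (ltrD fu eu))//.
  by rewrite -addrA -splitr subrKC.
move=> Ce; near (0 : K)^'+ => e.
have e0 : 0 < e by near: e; exact: nbhs_right_gt.
have e2 : e < `|f| / 2 by near: e; exact: nbhs_right_lt.
have Cfe : C `<=` (fun t => `|f t| + e < `|f|) by near: e.
suff : `|f| <= `|f| - e by rewrite lerDl oppr_ge0 lt_geF.
apply: C0_norm_le => [|t].
  by rewrite subr_ge0 (le_trans (ltW e2))// ler_pdivrMr// ler_peMr ?ltW// ltr1n.
have [/Cfe|/Cf ft] := pselect (C t); first by rewrite -ltrBrDr => /ltW.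
by rewrite (le_trans (ltW ft))// lerBrDr [leRHS]splitr lerD2l ltW.
Unshelve. all: by end_near. Qed.

(** Urysohn's lemma yields real functions, while elements of [Y] are multiplied
    by scalars in [K], which may be complex. *)
Lemma real_embedding : exists j : {rmorphism R -> K},
  {mono j : x y / x <= y} /\ continuous j.
Proof.
case: k => /=; first by exists idfun; split=> // x; exact: cvg_id.
exists (real_complex R); split; first exact: lecR.
move=> x; apply/cvgrPdist_lt => e e0.
have e_re : (complex.Re e)%:C%C = e by rewrite RRe_real// gtr0_real.
have re0 : 0 < complex.Re e by rewrite -ltcR e_re.
have xe : \forall y \near x, `|x - y| < complex.Re e.
  exact: ((cvgrPdist_lt _ _).1 (@cvg_id _ (nbhs x))).
apply: filterS xe => y.
by rewrite -rmorphB normc_def /= expr0n addr0 sqrtr_sqr -{2}e_re ltcR.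
Qed.

(** Local compactness makes [L] completely regular, and provides a compact
    neighborhood [C] of [t0].  A function separating [t0] from the complement of
    the interior of [C] is supported in [C], hence vanishes at infinity. *)
Lemma exists_bump (t0 : L) :
  locally_compact [set: L] -> hausdorff_space L ->
  exists phi : L -> K, [/\ continuous phi, forall t, 0 <= phi t <= 1,
    phi t0 = 1 & exists2 C, compact C & forall t, ~ C t -> phi t = 0].
Proof.
move=> lcL hL.
have [C] := lcL t0 I; rewrite withinET => Ct0 [cC _].
have clC : closed (~` C°) by apply: open_closedC; exact: open_interior.
have nCt0 : ~ (~` C°) t0 by apply.
have [g [cg g01 g0 g1]] := (uniform_separatorP (R := R) _ _).1
  (locally_compact_completely_regular (R := R) lcL hL clC nCt0).
have [j [jle cj]] := real_embedding.
exists (fun t => j (1 - g t)); split.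
- move=> t; apply: (@continuous_comp _ _ _ (fun u => 1 - g u) j); last exact: cj.
  by apply: cvgB; [exact: cvg_cst|exact: cg].
- move=> t; have := g01 (g t) (ex_intro2 _ _ t I erefl).
  rewrite /= in_itv /= => /andP[gt0 gt1].
  by rewrite -(rmorph0 j) -(rmorph1 j) !jle subr_ge0 gt1 gerBl.
- by rewrite (g0 (g t0)); [rewrite subr0 rmorph1|exists t0].
- exists C => // t nCt; rewrite (g1 (g t)); first by rewrite subrr rmorph0.
  by exists t => // /interior_subset.
Qed.

Section bump_composition.
Variables (X Y : normedModType K) (phi : L -> K) (T : {linear X -> Y}).
Hypotheses (phi_cont : continuous phi)
  (phi_supp : exists2 C, compact C & forall t, ~ C t -> phi t = 0).

Lemma scale_bump_in_C0 (y : Y) : (fun t => phi t *: y) \in @C0_pred R k L Y.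
Proof.
apply/asboolP; split; first by move=> t; apply: cvgZr_tmp; exact: phi_cont.
move=> e e0; have [C cC C0] := phi_supp; exists C => // t /C0 ->.
by rewrite scale0r normr0.
Qed.

Definition scale_bump (x : X) : C0 L Y := MkC0 (scale_bump_in_C0 (T x)).

Lemma scale_bump_linear : linear scale_bump.
Proof.
move=> a x y; apply/val_inj/funext => t /=.
by rewrite linearP scalerDr scalerA mulrC -scalerA.
Qed.

HB.instance Definition _ :=
  GRing.isLinear.Build K X (C0 L Y) _ scale_bump scale_bump_linear.

End bump_composition.

Section evaluation.
Variables (X Y : normedModType K) (S : {linear X -> C0 L Y}) (t : L).

Definition eval_op (x : X) : Y := S x t.

Lemma eval_op_linear : linear eval_op.
Proof. by move=> a x y; rewrite /eval_op linearP. Qed.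

HB.instance Definition _ :=
  GRing.isLinear.Build K X Y _ eval_op eval_op_linear.

End evaluation.

End C0_functions.

Theorem theorem2p3 (R : realType) (k : scalar_kind)
  (X Y : completeNormedModType (scalar_field R k)) (L : topologicalType)
  (L_nonempty : [set: L] !=set0)
  (L_locally_compact : locally_compact [set: L])
  (L_hausdorff : hausdorff_space L) :
  BPBp X (C0 L Y) -> BPBp X Y.
Proof.
move=> bpb eps eps0.
(* The final bound is the non-strict [2 * delta], as it comes from a supremum;
   so [delta] must be smaller than [eps / 2]. *)
pose delta : scalar_field R k := eps / 3.
have delta0 : 0 < delta by rewrite divr_gt0.
have [eta eta0 bpb_eta] := bpb delta delta0.
exists eta => // T x0 sT x01 Tx0.
have [t0 _] := L_nonempty.
have [phi [cphi phi01 phit0 sphi]] :=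
  @exists_bump R k L t0 L_locally_compact L_hausdorff.
pose T' : {linear X -> C0 L Y} := scale_bump T cphi sphi.
have T'le x : `|T' x| <= `|T x|.
  apply: C0_norm_le => // t.
  have /andP[p0 p1] := phi01 t.
  by rewrite /= normrZ ger0_norm// ler_piMl.
have T'ge x : `|T x| <= `|T' x|.
  by have := C0_norm_ub (T' x) t0; rewrite /= phit0 scale1r.
have T'T x : `|T' x| = `|T x| by apply/le_anti; rewrite T'le T'ge.
have sT' : op_sphere T' by exact: op_sphere_eq_norm T'T sT.
rewrite -T'T in Tx0.
have [S [u0 [sS u01 Su01 u0x0 ST]]] := bpb_eta T' x0 sT' x01 Tx0.
have [t1 Su0t1] : exists t, `|S u0 t| = `|S u0|.
  by apply: C0_norm_attained; rewrite -normr_gt0 Su01.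
rewrite Su01 in Su0t1.
pose S1 : {linear X -> Y} := eval_op S t1.
have S1le x : `|S1 x| <= `|x|.
  exact: le_trans (C0_norm_ub (S x) t1) (op_sphere_contraction sS x).
have /andP[p0 p1] := phi01 t1.
have S1phi x : `|S1 x - phi t1 *: T x| <= delta * `|x|.
  apply: le_trans (C0_norm_ub (S x - T' x) t1) _.
  have bST : bounded_op (S \- T').
    exists 2 => y; rewrite mulr2n mulrDl mul1r (le_trans (ler_normB _ _))//.
    by rewrite lerD ?op_sphere_contraction.
  by rewrite (le_trans (opnorm_ub x bST))// ler_wpM2r// ltW.
(* At the norming vector, [1 = `|S1 u0| <= phi t1 * `|T u0| + delta]. *)
have phi_delta : 1 - phi t1 <= delta.
  have := S1phi u0; rewrite u01 mulr1; apply: le_trans.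
  rewrite (le_trans _ (lerB_dist _ _))// [`|S1 u0|]Su0t1 lerB//.
  by rewrite normrZ ger0_norm// ler_piMr// -u01 op_sphere_contraction.
exists S1, u0; split=> //.
- exact: op_sphere_attained S1le u01 Su0t1.
- by rewrite (lt_trans u0x0)// ltr_pdivrMr// ltr_pMr// ltr1n.
have d2 : delta + delta < eps.
  by rewrite -mulrDl ltr_pdivrMr// -mulr2n -[ltLHS]mulr_natr ltr_pM2l// ltr_nat.
apply: le_lt_trans d2; apply: opnorm_le => [|x]; first by rewrite addr_ge0// ltW.
rewrite /= -(subrKA (phi t1 *: T x)) mulrDl (le_trans (ler_normD _ _))//.
rewrite lerD ?S1phi// -[X in _ - X]scale1r -scalerBl normrZ distrC.
rewrite ger0_norm ?subr_ge0// (le_trans (ler_wpM2r (normr_ge0 _) phi_delta))//.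
by rewrite ler_wpM2l ?op_sphere_contraction// ltW.
Qed.
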